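(* For $u,v,n \in \mathbb{N}$, let $C_4(u,v,n)$ denote the number of partitions of $n$ into $u$ distinct parts congruent to $1$ modulo $4$ and $v$ distinct parts congruent to $3$ modulo $4$ (all parts distinct). Let $D_4(u,v,n)$ denote the number of partitions $\lambda_1 + \cdots + \lambda_s$ of $n$ (positive integer parts, $\lambda_1\ge\lambda_2\ge\cdots\ge\lambda_s$) such that $u$ equals the number of parts congruent to $0$ or $1$ modulo $4$ plus twice the number of parts congruent to $6$ modulo $8$, and $v$ equals the number of parts congruent to $0$ or $3$ modulo $4$ plus twice the number of parts congruent to $2$ modulo $8$, satisfying the following conditions: (1) for all $i$, $\lambda_i \neq 2$; (2) for all $1\le i<s$, $\lambda_i - \lambda_{i+1} \geq 5$; (3) for all $1\le i<s$: if $\lambda_i - \lambda_{i+1} = 5$ then $\lambda_i \equiv 1, 4 \pmod 8$; if $\lambda_i - \lambda_{i+1} = 6$ then $\lambda_i \equiv 1, 3, 5, 7 \pmod 8$; if $\lambda_i - \lambda_{i+1} = 7$ then $\lambda_i \equiv 0, 1, 3, 4, 6, 7 \pmod 8$; if $\lambda_i - \lambda_{i+1} = 8$ then $\lambda_i \equiv 0, 1, 3, 4, 5, 7 \pmod 8$. Then $C_4(u,v,n)=D_4(u,v,n)$ for all $u,v,n\in\mathbb{N}$. *)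

(* Defs.v *)
From mathcomp Require Import all_boot.
Set Implicit Arguments. Unset Strict Implicit. Unset Printing Implicit Defensive.

(* A partition of n into DISTINCT positive parts is encoded as a finite set
   A of elements of 'I_(n.+1) (i.e. naturals <= n) with 0 \notin A and
   sum of elements = n.  Partitions counted by D4 automatically have
   distinct parts (consecutive gaps >= 5), so the same encoding is used. *)

Definition is_dpart (n : nat) (A : {set 'I_n.+1}) : bool :=
  (ord0 \notin A) && (\sum_(i in A) (i : nat) == n).

Definition nparts (n : nat) (A : {set 'I_n.+1}) (p : pred nat) : nat :=
  #|[set i in A | p (i : nat)]|.

Definition C4 (u v n : nat) : nat :=
  #|[set A : {set 'I_n.+1} | [&& is_dpart A,
      [forall i in A, (odd i)],
      nparts A (fun k => k %% 4 == 1) == u &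
      nparts A (fun k => k %% 4 == 3) == v]]|.

Definition gap_ok (a b : nat) : bool :=
  let d := a - b in
  [&& 5 <= d,
      (d == 5) ==> (a %% 8 \in [:: 1; 4]),
      (d == 6) ==> (a %% 8 \in [:: 1; 3; 5; 7]),
      (d == 7) ==> (a %% 8 \in [:: 0; 1; 3; 4; 6; 7]) &
      (d == 8) ==> (a %% 8 \in [:: 0; 1; 3; 4; 5; 7])].

Definition consecutive (n : nat) (A : {set 'I_n.+1}) (x y : 'I_n.+1) : bool :=
  [&& x \in A, y \in A, (y : nat) < x &
      [forall z in A, ~~ (((y : nat) < z) && ((z : nat) < x))]].

Definition D4 (u v n : nat) : nat :=
  #|[set A : {set 'I_n.+1} | [&& is_dpart A,
      [forall i in A, (i : nat) != 2],
      [forall x, forall y, consecutive A x y ==> gap_ok x y],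
      nparts A (fun k => (k %% 4 == 0) || (k %% 4 == 1))
        + 2 * nparts A (fun k => k %% 8 == 6) == u &
      nparts A (fun k => (k %% 4 == 0) || (k %% 4 == 3))
        + 2 * nparts A (fun k => k %% 8 == 2) == v]]|.

(* Main.v *)
(* Let G_m(a, b) be the generating function, with weights a^u b^v q^n, of the
   partitions counted by D4 whose parts are at most m. Conditioning on the
   largest part gives linear recurrences for G_{8k+1}, G_{8k+4} and an auxiliary
   series, and these imply the finite identity
     G_{8k+4}(a, b) = (1 + a q) G_{8k+1}(b q^2, a q^2).
   The substitution (a, b) -> (b q^2, a q^2) adds 2 to every odd part and swaps
   the classes 1 and 3 modulo 4, so iterating the identity produces the factors
   1 + a q, 1 + b q^3, 1 + a q^5, ..., whose product is the generating function
   of the partitions counted by C4. *)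

Require Import Defs.
From mathcomp Require Import all_boot all_algebra zify ring.
Set Implicit Arguments. Unset Strict Implicit. Unset Printing Implicit Defensive.
Import GRing.Theory Num.Theory.
Local Open Scope ring_scope.

(** * Weights and generating functions by largest part *)

Definition wa (m : nat) : nat :=
  (((m %% 4 == 0) || (m %% 4 == 1)) + 2 * (m %% 8 == 6))%N.

Definition wb (m : nat) : nat :=
  (((m %% 4 == 0) || (m %% 4 == 3)) + 2 * (m %% 8 == 2))%N.

(** For odd [m] exactly one of [wa m], [wb m] is 1 and the other 0, according to [m] modulo 4, so
    the same weight serves the partitions of [C4]. *)
Definition wt (R : comNzRingType) (a b q : R) (m : nat) : R :=
  a ^+ wa m * b ^+ wb m * q ^+ m.

(* [j] is the part following [m], with [j = 0] when [m] is the last part. *)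
Definition next_ok (m j : nat) : bool := (j == 0%N) || gap_ok m j.

Fixpoint topgf_fuel (R : comNzRingType) (a b q : R) (f m : nat) : R :=
  if f is f'.+1 then
    if m == 0%N then 1
    else (m != 2)%:R * wt a b q m
         * \sum_(j < m | next_ok m j) topgf_fuel a b q f' j
  else 0.

(* Generating function of the partitions with largest part exactly m; the fuel
   only makes the course-of-values recursion structural. *)
Definition topgf (R : comNzRingType) (a b q : R) (m : nat) : R :=
  topgf_fuel a b q m.+1 m.

Definition gf (R : comNzRingType) (a b q : R) (m : nat) : R :=
  \sum_(j < m.+1) topgf a b q j.

Lemma topgf_fuelE (R : comNzRingType) (a b q : R) (f m : nat) :
  (m < f)%N -> topgf_fuel a b q f m = topgf a b q m.
Proof.
rewrite /topgf; elim/ltn_ind: m f => m IHm [//|f] ltmf /=.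
case: eqP => // _; congr (_ * _); apply: eq_bigr => j _.
by rewrite !(IHm j) // (leq_trans (ltn_ord j)).
Qed.

Lemma topgf0 (R : comNzRingType) (a b q : R) : topgf a b q 0 = 1.
Proof. by []. Qed.

Lemma topgfE (R : comNzRingType) (a b q : R) (m : nat) : (0 < m)%N ->
  topgf a b q m =
    (m != 2)%:R * wt a b q m * \sum_(j < m | next_ok m j) topgf a b q j.
Proof.
case: m => [//|m] _; rewrite /topgf [LHS]/= -/topgf_fuel; congr (_ * _).
apply: eq_bigr => j _.
by rewrite -[RHS]/(topgf a b q j) -(@topgf_fuelE _ _ _ _ m.+1).
Qed.

Lemma gfS (R : comNzRingType) (a b q : R) (m : nat) :
  gf a b q m.+1 = gf a b q m + topgf a b q m.+1.
Proof. exact: big_ord_recr. Qed.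

(** * Recurrences along residues modulo 8 *)

Lemma topgf_prefix (R : comNzRingType) (a b q : R) (m l : nat) :
  (l < m)%N -> m != 2 ->
  (forall j, (j < m)%N -> next_ok m j = (j <= l)%N) ->
  topgf a b q m = wt a b q m * gf a b q l.
Proof.
move=> ltlm m2 okE; rewrite topgfE ?(leq_ltn_trans _ ltlm) // m2 mul1r.
congr (_ * _); rewrite /gf (big_ord_widen_cond _ xpredT _ ltlm).
by apply: eq_bigl => j; rewrite okE.
Qed.

(** Needed for parts 4, 5, 6 modulo 8, whose admissible next parts form an initial segment plus one
    isolated value. *)
Lemma topgf_prefix1 (R : comNzRingType) (a b q : R) (m l x : nat) :
  (l < x < m)%N -> m != 2 ->
  (forall j, (j < m)%N -> next_ok m j = (j <= l)%N || (j == x)) ->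
  topgf a b q m = wt a b q m * (gf a b q l + topgf a b q x).
Proof.
move=> /andP[ltlx ltxm] m2 okE; have ltlm := ltn_trans ltlx ltxm.
rewrite topgfE ?(leq_ltn_trans _ ltlm) // m2 mul1r.
congr (_ * _); rewrite /gf (big_ord_widen_cond _ xpredT _ ltlm).
rewrite (bigD1 (Ordinal ltxm)) /= ?okE ?eqxx ?orbT // addrC.
congr (_ + _); apply: eq_bigl => j; rewrite okE // -val_eqE /=; lia.
Qed.

Lemma wt_periodic (R : comNzRingType) (a b q : R) (k r : nat) :
  wt a b q (8 * k + r) = a ^+ wa r * b ^+ wb r * (q ^+ (8 * k) * q ^+ r).
Proof.
rewrite /wt -exprD; congr (_ ^+ _ * _ ^+ _ * _); rewrite /wa /wb; lia.
Qed.

(* The partitions to which a part 8k+4, 8k+5 or 8k+6 may be prepended: the gap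
   conditions allow the same set of tails in the three cases. *)
Definition pregf (R : comNzRingType) (a b q : R) (k : nat) : R :=
  if k is k'.+1 then gf a b q (8 * k' + 5) + topgf a b q (8 * k' + 7) else 1.

Ltac next_ok_lia := rewrite /next_ok /gap_ok !inE; lia.

Ltac wt_expand r x y :=
  rewrite wt_periodic -[wa r]/x -[wb r]/y; ring.

Lemma topgf_pregf (R : comNzRingType) (a b q : R) (k r : nat) :
  (3 < r < 7)%N ->
  topgf a b q (8 * k + r) = wt a b q (8 * k + r) * pregf a b q k.
Proof.
move=> lt_r; case: k => [|k].
  (* Nothing positive can follow 4, 5 or 6: the only gap reaching 5 is 6 - 1, and 6 is not an
     allowed residue for it. *)
  rewrite muln0 (@topgf_prefix _ _ _ _ _ 0); [|lia|lia|].
    by rewrite /gf big_ord_recl big_ord0 addr0.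
  by move: r lt_r => [|[|[|[|[|[|[|r]]]]]]] // _ j ?; next_ok_lia.
apply: topgf_prefix1; [lia | lia |].
by move: r lt_r => [|[|[|[|[|[|[|r]]]]]]] // _ j ?; next_ok_lia.
Qed.

Lemma topgf_8kD4 (R : comNzRingType) (a b q : R) (k : nat) :
  topgf a b q (8 * k + 4) = a * b * q ^+ 4 * q ^+ (8 * k) * pregf a b q k.
Proof. rewrite topgf_pregf //; wt_expand 4%N 1%N 1%N. Qed.

Lemma topgf_8kD5 (R : comNzRingType) (a b q : R) (k : nat) :
  topgf a b q (8 * k + 5) = a * q ^+ 5 * q ^+ (8 * k) * pregf a b q k.
Proof. rewrite topgf_pregf //; wt_expand 5%N 1%N 0%N. Qed.

Lemma topgf_8kD6 (R : comNzRingType) (a b q : R) (k : nat) :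
  topgf a b q (8 * k + 6) = a ^+ 2 * q ^+ 6 * q ^+ (8 * k) * pregf a b q k.
Proof. rewrite topgf_pregf //; wt_expand 6%N 2%N 0%N. Qed.

Lemma topgf_8kD7 (R : comNzRingType) (a b q : R) (k : nat) :
  topgf a b q (8 * k + 7) = b * q ^+ 7 * q ^+ (8 * k) * gf a b q (8 * k + 1).
Proof.
rewrite (@topgf_prefix _ _ _ _ _ (8 * k + 1)); [|lia|lia|
  by move=> j ?; next_ok_lia].
wt_expand 7%N 0%N 1%N.
Qed.

Lemma topgf_8kD8 (R : comNzRingType) (a b q : R) (k : nat) :
  topgf a b q (8 * k + 8) = a * b * q ^+ 8 * q ^+ (8 * k) * gf a b q (8 * k + 1).
Proof.
rewrite (@topgf_prefix _ _ _ _ _ (8 * k + 1)); [|lia|lia|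
  by move=> j ?; next_ok_lia].
wt_expand 8%N 1%N 1%N.
Qed.

Lemma topgf_8kD9 (R : comNzRingType) (a b q : R) (k : nat) :
  topgf a b q (8 * k + 9) = a * q ^+ 9 * q ^+ (8 * k) * gf a b q (8 * k + 4).
Proof.
rewrite (@topgf_prefix _ _ _ _ _ (8 * k + 4)); [|lia|lia|
  by move=> j ?; next_ok_lia].
wt_expand 9%N 1%N 0%N.
Qed.

Lemma topgf_8kD10 (R : comNzRingType) (a b q : R) (k : nat) :
  topgf a b q (8 * k + 10)
  = b ^+ 2 * q ^+ 10 * q ^+ (8 * k) * gf a b q (8 * k + 1).
Proof.
rewrite (@topgf_prefix _ _ _ _ _ (8 * k + 1)); [|lia|lia|
  by move=> j ?; next_ok_lia].
wt_expand 10%N 0%N 2%N.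
Qed.

Lemma topgf_8kD11 (R : comNzRingType) (a b q : R) (k : nat) :
  topgf a b q (8 * k + 11)
  = b * q ^+ 11 * q ^+ (8 * k) * gf a b q (8 * k + 5).
Proof.
rewrite (@topgf_prefix _ _ _ _ _ (8 * k + 5)); [|lia|lia|
  by move=> j ?; next_ok_lia].
wt_expand 11%N 0%N 1%N.
Qed.

Lemma gf_addS (R : comNzRingType) (a b q : R) (m r : nat) :
  gf a b q (m + r.+1) = gf a b q (m + r) + topgf a b q (m + r.+1).
Proof. by rewrite addnS gfS. Qed.

(** Adds the largest parts 8k+5 to 8k+12 one at a time. Here [t] is the series up to 8k+5, and 8k+12
    = 8(k+1)+4 already has the new [y'] as its tails. *)
Lemma gf_step (R : comNzRingType) (a b q : R) (k : nat) :
  let s := gf a b q (8 * k + 1) in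
  let p := gf a b q (8 * k + 4) in
  let y := pregf a b q k in
  let Q := q ^+ (8 * k) in
  let t := p + a * q ^+ 5 * Q * y in
  let s' := t + a ^+ 2 * q ^+ 6 * Q * y
            + (b * q ^+ 7 + a * b * q ^+ 8) * Q * s + a * q ^+ 9 * Q * p in
  let y' := t + b * q ^+ 7 * Q * s in
  [/\ gf a b q (8 * k.+1 + 1) = s', pregf a b q k.+1 = y' &
      gf a b q (8 * k.+1 + 4)
      = s' + b ^+ 2 * q ^+ 10 * Q * s + b * q ^+ 11 * Q * t
        + a * b * q ^+ 12 * Q * y'].
Proof.
move=> s p y Q t s' y'.
have E5 : gf a b q (8 * k + 5) = t by rewrite gf_addS topgf_8kD5.
have Ey : pregf a b q k.+1 = y' by rewrite /= E5 topgf_8kD7.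
have E9 : gf a b q (8 * k + 9) = s'.
  rewrite !(gf_addS _ _ _ _ 8, gf_addS _ _ _ _ 7, gf_addS _ _ _ _ 6,
            gf_addS _ _ _ _ 5) E5 topgf_8kD6 topgf_8kD7 topgf_8kD8 topgf_8kD9.
  rewrite /s' /t /s /p /y /Q; ring.
have E12 : topgf a b q (8 * k + 12) = a * b * q ^+ 12 * Q * y'.
  have -> : (8 * k + 12 = 8 * k.+1 + 4)%N by lia.
  by rewrite topgf_8kD4 Ey mulnS exprD /Q; ring.
split => //.
  by rewrite -E9; congr gf; lia.
have -> : (8 * k.+1 + 4 = 8 * k + 12)%N by lia.
rewrite !(gf_addS _ _ _ _ 11, gf_addS _ _ _ _ 10, gf_addS _ _ _ _ 9).
by rewrite E9 topgf_8kD10 topgf_8kD11 E5 E12.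
Qed.

(** * The finite identity *)

Lemma gf_init (R : comNzRingType) (a b q : R) :
  gf a b q 1 = 1 + a * q
  /\ gf a b q 4 = 1 + a * q + b * q ^+ 3 + a * b * q ^+ 4.
Proof.
have e2 : topgf a b q 2 = 0 by rewrite topgfE //= !mul0r.
have e1 : topgf a b q 1 = a * q.
  rewrite (@topgf_prefix _ _ _ _ _ 0) //; last by move=> j ?; next_ok_lia.
  rewrite /gf big_ord_recl big_ord0 topgf0 /wt -[wa 1]/1%N -[wb 1]/0%N; ring.
have e3 : topgf a b q 3 = b * q ^+ 3.
  rewrite (@topgf_prefix _ _ _ _ _ 0) //; last by move=> j ?; next_ok_lia.
  rewrite /gf big_ord_recl big_ord0 topgf0 /wt -[wa 3]/0%N -[wb 3]/1%N; ring.
have e4 := topgf_8kD4 a b q 0; rewrite muln0 add0n /= in e4.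
have g1 : gf a b q 1 = 1 + a * q by rewrite /gf !big_ord_recr big_ord0 /= e1 add0r.
split => //.
rewrite (gfS _ _ _ 3) (gfS _ _ _ 2) (gfS _ _ _ 1) g1 e2 e3 e4; ring.
Qed.

(* The first equation is the identity of interest; the other two close the
   induction, since (gf (8k+1), gf (8k+4), pregf k) determines its successor. *)
Lemma gf_shift_invariant (R : comNzRingType) (a b q : R) (k : nat) :
  let c := 1 + a * q in
  let a' := b * q ^+ 2 in
  let b' := a * q ^+ 2 in
  [/\ gf a b q (8 * k + 4) = c * gf a' b' q (8 * k + 1),
      gf a b q (8 * k + 1) = c * pregf a' b' q k &
      c * gf a' b' q (8 * k + 4)
      = gf a b q (8 * k + 4) + a * q ^+ 5 * q ^+ (8 * k) * c * pregf a b q k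
        + a * b * q ^+ 8 * q ^+ (8 * k) * gf a b q (8 * k + 1)].
Proof.
move=> c a' b'; elim: k => [|k [H1 H2 H3]].
  rewrite muln0 !add0n /=.
  have [-> ->] := gf_init a b q; have [-> ->] := gf_init a' b' q.
  by rewrite /c /a' /b'; split; ring.
have [-> -> ->] := gf_step a b q k; have [-> -> ->] := gf_step a' b' q k.
have -> : q ^+ (8 * k.+1) = q ^+ 8 * q ^+ (8 * k) by rewrite mulnS exprD.
set Q := q ^+ (8 * k) in H3 *; set p := gf a b q (8 * k + 4) in H1 H3 *.
set s := gf a b q (8 * k + 1) in H2 H3 *; set y := pregf a b q k in H3 *.
set S := gf a' b' q (8 * k + 1) in H1 *; set Y := pregf a' b' q k in H2 *.
set P := gf a' b' q (8 * k + 4) in H3 *.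
(* The left factor, called [T] below, is [gf a' b' q (8 * k + 5)]. Multiplied by [c], each shifted
   series becomes an unshifted one through the induction hypotheses; [cs] and [cy] do the same up to
   8k+9 and for [pregf]. *)
have cT : c * (P + a' * q ^+ 5 * Q * Y)
    = p + (a * q ^+ 5 * c) * Q * y + (b * q ^+ 7 + a * b * q ^+ 8) * Q * s.
  by rewrite mulrDr H3 H2 /a'; ring.
set T := P + _ in cT *.
have cs : c * (T + a' ^+ 2 * q ^+ 6 * Q * Y + (b' * q ^+ 7 + a' * b' * q ^+ 8) * Q * S
    + a' * q ^+ 9 * Q * P)
  = c * T + b ^+ 2 * q ^+ 10 * Q * (c * Y) + (a * q ^+ 9 + a * b * q ^+ 12) * Q * (c * S)
    + b * q ^+ 11 * Q * (c * P) by rewrite /a' /b'; ring.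
rewrite cT -H1 -H2 H3 in cs.
set s1 := T + _ + _ + _ in cs *.
have cy : c * (T + b' * q ^+ 7 * Q * S) = c * T + a * q ^+ 9 * Q * (c * S).
  by rewrite /b'; ring.
rewrite cT -H1 in cy.
split.
- by rewrite cs /c; ring.
- by rewrite cy /c; ring.
set y1 := T + b' * _ * _ * _ in cy *.
have -> : c * (s1 + b' ^+ 2 * q ^+ 10 * Q * S + b' * q ^+ 11 * Q * T
    + a' * b' * q ^+ 12 * Q * y1)
  = c * s1 + a ^+ 2 * q ^+ 14 * Q * (c * S) + a * q ^+ 13 * Q * (c * T)
    + a * b * q ^+ 16 * Q * (c * y1) by rewrite /a' /b'; ring.
by rewrite cs cy cT -H1 /c; ring.
Qed.

(** * Iteration modulo powers of q *)

(** Replaces q-adic limits: the coefficient of q^n only sees finitely many factors of the infinite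
    product. *)
Definition eqmod_pow (R : comNzRingType) (q : R) (N : nat) (x y : R) : Prop :=
  exists c, x = y + q ^+ N * c.

(** Every residue modulo 8 has [wa] + [wb] positive, so the part [m] alone brings one q^s, through a
    or b, besides its own q^m. *)
Lemma topgf_dvd (R : comNzRingType) (a b q : R) (s m : nat) : (0 < m)%N ->
  exists c, topgf (a * q ^+ s) (b * q ^+ s) q m = q ^+ (s + m) * c.
Proof.
move=> m_gt0; rewrite topgfE //; set S := \sum_(_ < _ | _) _.
have ab_gt0 : (0 < wa m + wb m)%N by rewrite /wa /wb; lia.
exists ((m != 2)%:R * a ^+ wa m * b ^+ wb m * q ^+ (s * (wa m + wb m).-1) * S).
have E : q ^+ (s * wa m) * q ^+ (s * wb m)
         = q ^+ s * q ^+ (s * (wa m + wb m).-1).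
  by rewrite -!exprD -mulnDr -mulnS prednK.
rewrite /wt !exprMn -!exprM exprD.
transitivity ((m != 2)%:R * a ^+ wa m * b ^+ wb m * q ^+ m * S
              * (q ^+ (s * wa m) * q ^+ (s * wb m))); first by ring.
by rewrite E; ring.
Qed.

Lemma gf_eqmod (R : comNzRingType) (a b q : R) (s m m' N : nat) :
  (m <= m')%N -> (N <= s + m.+1)%N ->
  eqmod_pow q N (gf (a * q ^+ s) (b * q ^+ s) q m')
                (gf (a * q ^+ s) (b * q ^+ s) q m).
Proof.
move=> /subnKC <- leN; elim: (m' - m)%N => [|d [c IHd]].
  by exists 0; rewrite addn0 mulr0 addr0.
have [e He] := topgf_dvd a b q s (ltn0Sn (m + d)).
exists (c + q ^+ (s + (m + d).+1 - N) * e).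
rewrite addnS gfS IHd He mulrDr mulrA -exprD addrA subnKC //; lia.
Qed.

Definition oddprod (R : comNzRingType) (a b q : R) (j : nat) : R :=
  \prod_(i < j) (1 + wt a b q (2 * i + 1)).

Lemma oddprod_recl (R : comNzRingType) (a b q : R) (j : nat) :
  oddprod a b q j.+1
  = (1 + a * q) * oddprod (b * q ^+ 2) (a * q ^+ 2) q j.
Proof.
rewrite /oddprod big_ord_recl; congr (_ * _).
  by rewrite /wt -[wa _]/1%N -[wb _]/0%N; ring.
apply: eq_bigr => i _; congr (1 + _); rewrite /wt lift0.
(* An odd part carries exactly one of the two weights, and adding 2 exchanges them. *)
have [[i1 i2]|[i1 i2]] : (wa (2 * i + 1) = 1 /\ wb (2 * i + 1) = 0)%N \/
    (wa (2 * i + 1) = 0 /\ wb (2 * i + 1) = 1)%N by rewrite /wa /wb; lia.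
  have -> : (wa (2 * i.+1 + 1) = 0)%N by move: i1 i2; rewrite /wa /wb; lia.
  have -> : (wb (2 * i.+1 + 1) = 1)%N by move: i1 i2; rewrite /wa /wb; lia.
  by rewrite i1 i2 mulnS -addnA [q ^+ (2 + _)]exprD; ring.
have -> : (wa (2 * i.+1 + 1) = 1)%N by move: i1 i2; rewrite /wa /wb; lia.
have -> : (wb (2 * i.+1 + 1) = 0)%N by move: i1 i2; rewrite /wa /wb; lia.
by rewrite i1 i2 mulnS -addnA [q ^+ (2 + _)]exprD; ring.
Qed.

(** Each use of the finite identity peels off one factor, swaps a and b and raises [s] by 2. It
    lands at 8k+1; returning to 8k+4 is harmless modulo q^N because N <= 8k+2. After [j] rounds the
    remaining series is 1 modulo q^(s+2j+1). *)
Lemma gf_oddprod_shift (R : comNzRingType) (q : R) (N k j : nat) :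
  (N <= 8 * k + 2)%N -> forall (a b : R) (s : nat), (N <= s + (2 * j).+1)%N ->
  eqmod_pow q N (gf (a * q ^+ s) (b * q ^+ s) q (8 * k + 4))
                (oddprod (a * q ^+ s) (b * q ^+ s) q j).
Proof.
move=> leNk; elim: j => [|j IHj] a b s leN.
  rewrite /oddprod big_ord0 -[1](_ : gf (a * q ^+ s) (b * q ^+ s) q 0 = 1).
    by apply: gf_eqmod; lia.
  by rewrite /gf big_ord_recl big_ord0 addr0.
have [-> _ _] := gf_shift_invariant (a * q ^+ s) (b * q ^+ s) q k.
rewrite oddprod_recl -![_ * _ * q ^+ 2]mulrA -!exprD.
have [|c IHc] := IHj b a (s + 2)%N; first by lia.
have [||d Hd] := @gf_eqmod R b a q (s + 2) (8 * k + 1) (8 * k + 4) N; [lia..|].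
exists ((1 + a * q ^+ s * q) * (c - d)).
have -> : gf (b * q ^+ (s + 2)) (a * q ^+ (s + 2)) q (8 * k + 1)
  = gf (b * q ^+ (s + 2)) (a * q ^+ (s + 2)) q (8 * k + 4) - q ^+ N * d.
  by rewrite Hd addrK.
by rewrite IHc; ring.
Qed.

Lemma oddprodE (R : comNzRingType) (a b q : R) (n : nat) :
  \prod_(i < n | odd i) (1 + wt a b q i) = oddprod a b q n./2.
Proof.
rewrite /oddprod; elim: n => [|n IHn]; first by rewrite !big_ord0.
rewrite big_mkcond big_ord_recr -big_mkcond /= IHn uphalf_half.
case: ifP => odd_n; last by rewrite mulr1 add0n.
by rewrite add1n big_ord_recr /=; congr (_ * (1 + wt _ _ _ _)); lia.
Qed.

Lemma gf_oddprod (R : comNzRingType) (a b q : R) (n : nat) :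
  eqmod_pow q n.+1 (gf a b q n) (\prod_(i < n.+1 | odd i) (1 + wt a b q i)).
Proof.
rewrite oddprodE -[a]mulr1 -[b]mulr1 -(expr0 q).
(* The bound [k := n] is merely large enough, and (n+1)/2 rounded down is the number of odd [i] at
   most [n]. *)
have [||c Hc] := @gf_oddprod_shift R q n.+1 n (n.+1)./2 _ a b 0; [lia..|].
have [||d Hd] := @gf_eqmod R a b q 0 n (8 * n + 4) n.+1; [lia..|].
exists (c - d); rewrite mulrBr addrA -Hc Hd; ring.
Qed.

(** * From series to sets of parts *)

Definition good (n : nat) (A : {set 'I_n.+1}) : bool :=
  [&& ord0 \notin A, [forall i in A, (i : nat) != 2] &
      [forall x, forall y, consecutive A x y ==> gap_ok x y]].

(** The empty set gets 0, which agrees with [next_ok], where 0 stands for no following part. *)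
Definition top (n : nat) (A : {set 'I_n.+1}) : nat := \max_(i in A) (i : nat).

Lemma top_leP (n : nat) (A : {set 'I_n.+1}) (m : nat) :
  reflect (forall x, x \in A -> (x <= m)%N) (top A <= m)%N.
Proof. exact: bigmax_leqP. Qed.

Lemma top_in (n : nat) (A : {set 'I_n.+1}) :
  A != set0 -> exists2 x, x \in A & top A = x.
Proof.
rewrite -card_gt0 => /(eq_bigmax_cond (fun i : 'I_n.+1 => i : nat)) [x xA topE].
by exists x.
Qed.

Lemma consecutiveP (n : nat) (A : {set 'I_n.+1}) (x y : 'I_n.+1) :
  reflect [/\ x \in A, y \in A, (y < x)%N &
           forall z, z \in A -> (y < z)%N -> (z < x)%N -> False]
          (consecutive A x y).
Proof.
apply: (iffP and4P) => -[xA yA ltyx H]; split => //.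
  by move=> z zA yz zx; have /forall_inP/(_ z zA) := H; rewrite yz zx.
by apply/forall_inP => z zA; apply/andP => -[yz zx]; exact: (H z).
Qed.

Lemma goodP (n : nat) (A : {set 'I_n.+1}) :
  reflect [/\ ord0 \notin A, forall i, i \in A -> (i : nat) <> 2 &
           forall x y, consecutive A x y -> gap_ok x y]
          (good A).
Proof.
apply: (iffP and3P) => -[A0 A2 Ag]; split => //.
- by move=> i /(forall_inP A2)/eqP.
- by move=> x y xy; have /forallP/(_ x)/forallP/(_ y)/implyP := Ag; apply.
- by apply/forall_inP => i /A2/eqP.
by apply/forallP => x; apply/forallP => y; apply/implyP; apply: Ag.
Qed.

(** Putting [m] above all of [B] keeps the consecutive pairs of [B] and creates only the pair of [m]
    with the top of [B]. *)
Lemma good_setU1 (n : nat) (B : {set 'I_n.+1}) (m : 'I_n.+1) :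
  (0 < m)%N -> m \notin B ->
  good (m |: B) && (top (m |: B) == m)
  = [&& (m : nat) != 2, good B, (top B < m)%N & next_ok m (top B)].
Proof.
move=> m0 mB.
have topU : (top (m |: B) == m) = (top B <= m)%N.
  by rewrite /top big_setU1 //=; lia.
have ltP : (top B < m)%N -> forall x, x \in B -> (x < m)%N.
  by move=> lt x xB; apply: leq_ltn_trans lt; apply/top_leP: x xB.
rewrite topU; apply/andP/and4P => [[/goodP[A0 A2 Ag] lemB]|[m2 /goodP[B0 B2 Bg] ltB ok]].
  have lt x : x \in B -> (x < m)%N.
    move=> xB; rewrite ltn_neqAle (top_leP _ _ lemB) // andbT.
    by apply: contraNneq mB => /val_inj <-.
  have ltB : (top B < m)%N.
    have [->|/top_in[x xB ->]] := eqVneq B set0; last exact: lt.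
    by rewrite /top big_set0.
  split=> //.
  - by apply/eqP/A2; rewrite setU11.
  - apply/goodP; split.
    + by apply: contraNN A0; apply: setU1r.
    + by move=> i iB; apply: A2; rewrite setU1r.
    + move=> x y /consecutiveP[xB yB ltyx H]; apply: Ag.
      apply/consecutiveP; split; rewrite ?setU1r // => z /setU1P[->|zB].
        by move=> _; rewrite ltnNge ltnW ?lt.
      exact: H.
  - have [->|/top_in[x xB Ex]] := eqVneq B set0; first by rewrite /top big_set0.
    rewrite /next_ok Ex; apply/orP; right; apply: Ag.
    apply/consecutiveP; split; rewrite ?setU11 ?setU1r ?lt // => z /setU1P[->|zB].
      by rewrite ltnn.
    by rewrite ltnNge -Ex (top_leP _ _ (leqnn _)).
split; last exact: ltnW.
apply/goodP; split.
- by rewrite !inE negb_or B0 andbT; apply: contraTneq m0 => <-.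
- by move=> i /setU1P[->|/B2 //]; apply/eqP.
move=> x y /consecutiveP[/setU1P[->|xB] /setU1P[->|yB] lt H].
- by rewrite ltnn in lt.
- have topy : top B = y.
    apply/eqP; rewrite eqn_leq [(y <= _)%N](top_leP _ _ (leqnn _)) // andbT.
    apply/top_leP => z zB; rewrite leqNgt; apply/negP => yz.
    by apply: (H z _ yz); rewrite ?setU1r ?ltP.
  move: ok; rewrite /next_ok topy => /orP[/eqP y0|//].
  by case/negP: B0; rewrite -(_ : y = ord0) //; apply: val_inj.
- by have := ltP ltB x xB; rewrite ltnNge ltnW.
apply: Bg; apply/consecutiveP; split => // z zB.
by apply: H; rewrite setU1r.
Qed.

Lemma top_eq0 (n : nat) (A : {set 'I_n.+1}) :
  good A && (top A == 0%N) = (A == set0).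
Proof.
apply/andP/eqP => [[/goodP[A0 _ _]]|->].
  have [//|/top_in[x xA ->]] := eqVneq A set0.
  by move/eqP => x0; case/negP: A0; rewrite -(_ : x = ord0) //; apply: val_inj.
split; last by rewrite /top big_set0.
apply/goodP; split=> [|i|x y]; rewrite ?inE //.
by case/consecutiveP; rewrite inE.
Qed.

(** Strong induction: deleting the largest element is a bijection onto the good sets whose top may
    follow [m], and grouping these by their top gives the recurrence [topgfE]. *)
Lemma topgf_sets (R : comNzRingType) (a b q : R) (n m : nat) : (m <= n)%N ->
  topgf a b q m
  = \sum_(A : {set 'I_n.+1} | good A && (top A == m)) \prod_(i in A) wt a b q i.
Proof.
elim/ltn_ind: m => -[|m] IHm lemn.
  rewrite (eq_bigl (pred1 set0)) ?big_pred1_eq ?big_set0 // => A.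
  exact: top_eq0.
pose i0 : 'I_n.+1 := inord m.+1; have i0E : i0 = m.+1 :> nat by rewrite inordK.
rewrite topgfE //.
transitivity ((m.+1 != 2)%:R * wt a b q m.+1 *
    \sum_(B : {set 'I_n.+1} | [&& good B, (top B < m.+1)%N & next_ok m.+1 (top B)])
       \prod_(i in B) wt a b q i).
  congr (_ * _); rewrite (partition_big (fun B => inord (top B) : 'I_m.+1)
                           (fun j => next_ok m.+1 j)) => [|B /and3P[_ lt ok]].
    apply: eq_bigr => j okj; rewrite IHm ?(leq_trans (ltnW (ltn_ord j))) //.
    apply: eq_bigl => B; rewrite -val_eqE /=.
    case: (good B) => //=; apply/eqP/andP => [->|[/andP[lt _]]].
      by rewrite ltn_ord okj inordK.
    by rewrite inordK // => /eqP.
  by rewrite inordK.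
rewrite -mulrA -i0E.
rewrite [RHS](reindex_onto (fun B => i0 |: B) (fun A => A :\ i0)) /=; last first.
  move=> A /andP[_ /eqP topA]; rewrite setD1K //.
  have [A0|/top_in[x xA Ex]] := eqVneq A set0.
    by move: topA; rewrite A0 /top big_set0 i0E.
  by rewrite (_ : i0 = x) //; apply: val_inj; rewrite /= -topA -Ex.
(* The clause left by the reindexing says that [i0] is not in [B]; if it is, [top B < i0] fails and
   both sides are false. *)
have condE B : good (i0 |: B) && (top (i0 |: B) == i0) && ((i0 |: B) :\ i0 == B)
   = ((i0 : nat) != 2) && [&& good B, (top B < i0)%N & next_ok i0 (top B)].
  have [iB|iB] := boolP (i0 \in B).
    rewrite [_ == B](_ : _ = false) ?andbF; last first.
      by apply/eqP => /setP/(_ i0); rewrite iB !inE eqxx.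
    apply/esym/negbTE; rewrite !negb_and -leqNgt.
    by rewrite [(i0 <= _)%N](top_leP _ _ (leqnn _)) ?orbT.
  by rewrite setU1K // eqxx andbT good_setU1 ?i0E.
rewrite (eq_bigl _ _ condE).
have [_|_] := eqVneq (i0 : nat) 2; first by rewrite mul0r big_pred0_eq.
rewrite mul1r mulr_sumr; apply: eq_bigr => B /and3P[_ lt _].
rewrite big_setU1 //=; apply: contraTN lt => iB.
by rewrite -leqNgt; apply: (top_leP _ _ (leqnn _)).
Qed.

Lemma gf_sets (R : comNzRingType) (a b q : R) (n : nat) :
  gf a b q n
  = \sum_(A : {set 'I_n.+1} | good A) \prod_(i in A) wt a b q i.
Proof.
rewrite /gf (partition_big (fun A => inord (top A) : 'I_n.+1) xpredT) //=.
apply: eq_bigr => j _; have lejn : (j <= n)%N by rewrite -ltnS.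
rewrite (topgf_sets a b q lejn).
apply: eq_bigl => A; rewrite -val_eqE /= inordK // ltnS.
by apply/top_leP => x _; rewrite -ltnS.
Qed.

Lemma odd_sets (R : comNzRingType) (a b q : R) (n : nat) :
  \prod_(i < n.+1 | odd i) (1 + wt a b q i)
  = \sum_(A : {set 'I_n.+1} | [forall i in A, odd i])
      \prod_(i in A) wt a b q i.
Proof.
rewrite big_mkcond.
under eq_bigr => i _.
  (* An even [i] gets the factor 0 + 1, so in the expansion every set with an even element
     contributes 0. *)
  rewrite (_ : (if _ then _ else _) = (if odd i then wt a b q i else 0) + 1); last first.
    by case: ifP; rewrite ?add0r // addrC.
  over.
rewrite bigA_distr /= [RHS]big_mkcond; apply: eq_bigr => A _.
rewrite -big_mkcond; case: ifP => [/forall_inP oddA|].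
  by apply: eq_bigr => i /oddA ->.
by case/forall_inPn => i iA /negbTE oddi; rewrite (bigD1 i) //= oddi mul0r.
Qed.

(** * Coefficient extraction *)

Lemma nparts_sum (n : nat) (A : {set 'I_n.+1}) (p : pred nat) :
  nparts A p = (\sum_(i in A) p i)%N.
Proof.
rewrite /nparts -sum1_card.
rewrite (eq_bigl (fun i => (i \in A) && p i)); last by move=> i; rewrite inE.
by rewrite big_mkcondr /=; apply: eq_bigr => i _; case: (p i).
Qed.

Lemma prod_wt (R : comNzRingType) (a b q : R) (n : nat) (A : {set 'I_n.+1}) :
  \prod_(i in A) wt a b q i
  = a ^+ (\sum_(i in A) wa i) * b ^+ (\sum_(i in A) wb i) * q ^+ (\sum_(i in A) i).
Proof. by rewrite -!prodrXr -!big_split. Qed.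

(* The variables a, b, q are encoded from the innermost polynomial outwards. *)
Lemma coef_monomial (i j k u v n : nat) :
  ('X%:P%:P ^+ i * 'X%:P ^+ j * 'X ^+ k : {poly {poly {poly int}}})`_n`_v`_u
  = [&& i == u, j == v & k == n]%:R.
Proof.
rewrite -!polyC_exp -polyCM coefCM coefXn mulr_natr !coefMn coefCM coefXn.
rewrite mulr_natr coefMn coefXn -!mulrnA !mulnb.
by rewrite [u == i]eq_sym [v == j]eq_sym [n == k]eq_sym.
Qed.

Lemma coef_sum_wt (u v n : nat) (P : pred {set 'I_n.+1}) :
  (\sum_(A | P A) \prod_(i in A) wt 'X%:P%:P 'X%:P ('X : {poly {poly {poly int}}}) i)
    `_n`_v`_u
  = #|[set A | [&& P A, (\sum_(i in A) (i : nat) == n)%N,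
       (\sum_(i in A) wa i == u)%N & (\sum_(i in A) wb i == v)%N]]|%:R.
Proof.
rewrite -sum1_card natr_sum 3!coef_sum.
rewrite big_mkcond [RHS]big_mkcond /=; apply: eq_bigr => A _.
rewrite inE prod_wt coef_monomial; case: (P A) => //=.
by case: (_ == u); case: (_ == v); case: (_ == n).
Qed.

Theorem theorem1p8 (u v n : nat) : C4 u v n = D4 u v n.
Proof.
apply/eqP; rewrite -(eqr_nat int); apply/eqP.
transitivity ((\prod_(i < n.+1 | odd i)
    (1 + wt 'X%:P%:P 'X%:P ('X : {poly {poly {poly int}}}) i))`_n`_v`_u).
  rewrite odd_sets coef_sum_wt; congr (_%:R); apply: eq_card => A; rewrite !inE.
  rewrite /is_dpart -andbA andbCA; case: forall_inP => [oddA|_]; last by rewrite !andbF.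
  have -> : ord0 \notin A by apply/negP => /oddA.
  by rewrite !nparts_sum /=; congr [&& _, _ == u & _ == v];
    apply: eq_bigr => i /oddA; rewrite /wa /wb; lia.
have [c Hc] := gf_oddprod 'X%:P%:P 'X%:P ('X : {poly {poly {poly int}}}) n.
transitivity ((gf 'X%:P%:P 'X%:P ('X : {poly {poly {poly int}}}) n)`_n`_v`_u).
  (* The error term is a multiple of q^(n+1), so its coefficient at q^n vanishes. *)
  by rewrite Hc coefD coefXnM ltnSn addr0.
rewrite gf_sets coef_sum_wt; congr (_%:R); apply: eq_card => A; rewrite !inE.
(* The doubled counts are merged into single sums of [wa] and [wb] over [A]. *)
rewrite /good /is_dpart !nparts_sum !big_distrr -!big_split /=.
rewrite -!andbA; congr (_ && _); rewrite [RHS]andbCA; congr (_ && _).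
by rewrite [RHS]andbCA.
Qed.
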